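(* Let $k$ be a field of characteristic two and let $k[x,y,z,w]$ be the polynomial ring in four variables over $k$. Consider the following three forms of a $k$-algebra automorphism $T$ of $k[x,y,z,w]$: (i) There is $f \in k[x,y,z]$ such that $T(x)=x$, $T(y)=y$, $T(z)=z$, $T(w)=w+f$. (ii) There are $\xi \in k[x,y]\setminus\{0\}$ and $\eta \in k[x,y,z]$ such that $T(x)=x$, $T(y)=y$, $T(z)=z+\xi$, $T(w)=w+\eta(x,\,y,\,z^2+\xi z)$. (iii) There are $\alpha \in k[x]\setminus\{0\}$, $\beta \in k[x,y]\setminus\{0\}$ and $\gamma \in k[x,y,z,w]$ such that, with $d := \gcd_{k[x,y]}(\alpha,\beta)$, $a := \alpha/d$, $b := \beta/d$ and $f_1 := x$, $f_2 := y^2+\alpha y$, $f_3 := z^2+\beta(x,\,y^2+\alpha y)\,z$, $f_4 := a z + b(x,\,y^2+\alpha y)\,y$, one has $T(x)=x$, $T(y)=y+\alpha(f_1)$, $T(z)=z+\beta(f_1,f_2)$, $T(w)=w+\gamma(f_1,f_2,f_3,f_4)$. Then: (1) Every $k$-algebra automorphism $T$ of $k[x,y,z,w]$ of any one of the forms (i), (ii), (iii) is an involution (i.e. $T^2=\mathrm{id}$). (2) For every triangular automorphism $\tau$ of $k[x,y,z,w]$, the following are equivalent: (2.1) $\tau$ is an involution; (2.2) there exist a $k$-algebra automorphism $\varphi$ of $k[x,y,z,w]$ and a triangular automorphism $T$ of $k[x,y,z,w]$ of one of the forms (i), (ii), (iii) such that $\tau = \varphi\circ T\circ\varphi^{-1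}$.
   Context: A $k$-algebra automorphism $\sigma$ of $k[x_1,\dots,x_n]$ is triangular if $\sigma(x_i)=\lambda_i x_i+\phi_i$ with $\lambda_i\in k\setminus\{0\}$ and $\phi_i\in k[x_1,\dots,x_{i-1}]$ for all $i$; here the variables are ordered $x_1=x$, $x_2=y$, $x_3=z$, $x_4=w$. An involution is an automorphism $\sigma$ with $\sigma^2=\mathrm{id}$. Notation such as $\eta(x,y,z^2+\xi z)$ means substituting the given polynomials for the variables of $\eta$; the gcd in (iii) is taken in $k[x,y]$ (any choice up to a unit). *)

(* Defs.v *)
From HB Require Import structures.
From mathcomp Require Import all_boot all_order all_algebra.
From mathcomp Require Import mpoly.
Set Implicit Arguments. Unset Strict Implicit. Unset Printing Implicit Defensive.
Import GRing.Theory.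
Local Open Scope ring_scope.

(* A k-algebra endomorphism of k[x1,x2,x3,x4] = {mpoly k[4]} is encoded by the
   4-tuple s of images of the variables x_(i+1) = 'X_i; it acts by
   p |-> p \mPo s (substitution).  Variables: x = 'X_0, y = 'X_1, z = 'X_2, w = 'X_3. *)
Section Defs.
Variable k : fieldType.
Notation P := {mpoly k[4]}.
Definition endo := 4.-tuple P.

Definition act (s : endo) (p : P) : P := comp_mpoly s p.

Definition vx : P := 'X_(0 : 'I_4).
Definition vy : P := 'X_(1 : 'I_4).
Definition vz : P := 'X_(2 : 'I_4).
Definition vw : P := 'X_(3 : 'I_4).

Definition mk4 (a b c d : P) : endo := [tuple a; b; c; d].

Definition id_endo : endo := [tuple 'X_i | i < 4].

(* composition as maps: act (ecomp s t) = act s \o act t *)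
Definition ecomp (s t : endo) : endo := [tuple act s (tnth t i) | i < 4].

Definition is_aut (s : endo) : Prop :=
  exists t : endo, ecomp s t = id_endo /\ ecomp t s = id_endo.

Definition involution (s : endo) : Prop := ecomp s s = id_endo.

Definition in_vars (m : nat) (p : P) : Prop :=
  forall mon, mon \in msupp p -> forall i : 'I_4, (m <= i)%N -> mon i = 0%N.

Definition triangular (s : endo) : Prop :=
  is_aut s /\
  forall i : 'I_4, exists lam : k, lam != 0 /\
    exists phi : P, in_vars i phi /\ tnth s i = lam *: 'X_i + phi.

Definition dvd_xy (d p : P) : Prop := exists q, in_vars 2 q /\ p = d * q.

(* d is a gcd of a and b in k[x,y] (any choice up to a unit) *)
Definition is_gcd_xy (d a b : P) : Prop :=
  [/\ in_vars 2 d, dvd_xy d a, dvd_xy d b &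
      forall e, in_vars 2 e -> dvd_xy e a -> dvd_xy e b -> dvd_xy e d].

Definition form_i (T : endo) : Prop :=
  exists f : P, in_vars 3 f /\ T = mk4 vx vy vz (vw + f).

Definition form_ii (T : endo) : Prop :=
  exists xi eta : P, [/\ in_vars 2 xi, xi != 0, in_vars 3 eta &
    T = mk4 vx vy (vz + xi)
          (vw + act (mk4 vx vy (vz ^+ 2 + xi * vz) vw) eta)].

Definition form_iii (T : endo) : Prop :=
  exists alpha beta gamma d a b : P,
    [/\ in_vars 1 alpha, alpha != 0, in_vars 2 beta, beta != 0 &
    [/\ is_gcd_xy d alpha beta, alpha = d * a, beta = d * b &
    let f1 := vx in
    let f2 := vy ^+ 2 + alpha * vy in
    let f3 := vz ^+ 2 + act (mk4 vx f2 vz vw) beta * vz in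
    let f4 := a * vz + act (mk4 vx f2 vz vw) b * vy in
    T = mk4 vx (vy + act (mk4 f1 vy vz vw) alpha)
            (vz + act (mk4 f1 f2 vz vw) beta)
            (vw + act (mk4 f1 f2 f3 f4) gamma)]].

Definition of_forms (T : endo) : Prop := form_i T \/ form_ii T \/ form_iii T.

End Defs.

(* Main.v *)
Require Import Defs.
From HB Require Import structures.
From mathcomp Require Import all_boot all_order all_algebra all_field.
From mathcomp Require Import mpoly ring.
Set Implicit Arguments. Unset Strict Implicit. Unset Printing Implicit Defensive.
Import GRing.Theory.
Local Open Scope ring_scope.

(** In characteristic two a triangular involution has the shape
    (x + c, y + p2, z + p3, w + p4) with each p_i fixed by the involution.
    If c <> 0, then x / c is translated by 1 and adding (x / c) p_i to the
    i-th variable makes it invariant: this is form (i) after permuting variables.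
    If c = 0, everything rests on the invariants of X |-> X + c, c <> 0, which
    are the polynomials in X^2 + c X: over them 1 and X generate everything, and
    the difference of p + q X and its image is c q. This yields form (ii)
    when p2 = 0, or when p3 = 0 after exchanging y and z.
    When p2 = alpha and p3 = beta(x, f2) are both nonzero, p4 is a combination
    p + q y + r z + s y z over k[x, f2, f3]; invariance gives s = 0 and
    q alpha = r beta. As a = alpha / d and b = beta / d are coprime, q = b t
    and r = a t by Gauss' lemma, whence p4 = p + t f4, which is form (iii). *)

(** * Induction and extensionality for multivariate polynomials *)

Lemma mpoly_ring_ind (n : nat) (R : nzRingType) (Q : {mpoly R[n]} -> Prop) :
    (forall c, Q c%:MP) -> (forall p q, Q p -> Q q -> Q (p + q)) ->
    (forall i p, Q p -> Q ('X_i * p)) ->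
  forall p, Q p.
Proof.
move=> QC QD QX; elim/mpolyind => [|c m p _ _ IH]; first by rewrite -mpolyC0.
apply: QD => //; rewrite -mul_mpolyC commr_mpolyX [X in X * _]mpolyXE_id.
move: (QC c); move: (c%:MP) => q; move: q.
apply: (big_ind (fun r => forall q, Q q -> Q (r * q))) => [q|r1 r2 H1 H2 q Qq|i _ q Qq].
- by rewrite mul1r.
- by rewrite -mulrA; apply/H1/H2.
by elim: (m i) => [|d IHd]; rewrite ?expr0 ?mul1r // exprS -mulrA; apply: QX.
Qed.

(** Identities between substitutions and changes of encoding are proved through this: only constants
    and variables have to be compared. *)
Lemma mpoly_rmorph_ext (n : nat) (R S : nzRingType) (f g : {rmorphism {mpoly R[n]} -> S}) :
  (forall c, f c%:MP = g c%:MP) -> (forall i, f 'X_i = g 'X_i) -> f =1 g.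
Proof.
move=> fgC fgX; elim/mpoly_ring_ind => // [p q|i p] Ep; first by rewrite !rmorphD Ep => ->.
by rewrite !rmorphM Ep fgX.
Qed.

(** * Divisibility of coefficients and Gauss' lemma over [F[x]] *)

(** Strong induction on the size: if [p] were not constant, its divisors of smaller size would be
    constant by induction, so [p] would be an irreducible divisor of itself. *)
Lemma size_le1_no_irreducible (F : fieldType) (p : {poly F}) : p != 0 ->
  (forall q, irreducible_poly q -> q %| p -> False) -> (size p <= 1)%N.
Proof.
have [n] := ubnP (size p); elim: n p => // n IH p; rewrite ltnS => le_pn p0 nirr.
rewrite leqNgt; apply/negP=> p_gt1; apply: (nirr p) => //; split=> // q q1 qp.
have q0 : q != 0 by apply: contraNneq p0 => q0; rewrite -dvd0p -q0.
rewrite -dvdp_size_eqp // eqn_leq dvdp_leq //= leqNgt; apply/negP=> lt_qp.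
have: (size q <= 1)%N.
  apply: IH => // [|r irr_r rq]; first exact: leq_trans le_pn.
  exact: nirr irr_r (dvdp_trans rq qp).
by rewrite leq_eqVlt (negPf q1) ltnS leqn0 size_poly_eq0 (negPf q0).
Qed.

(** The map is evaluation at a root [z] of [p] in an extension of [F]. When [p] does not divide [q],
    irreducibility makes them coprime, and then [z] is not a root of [q]. *)
Lemma irreducible_poly_ker (F : fieldType) (p : {poly F}) : irreducible_poly p ->
  exists (L : fieldType) (h : {rmorphism {poly F} -> L}), forall q, h q = 0 <-> p %| q.
Proof.
move=> irr_p; have [L _ [z pz _]] := irredp_FAdjoin irr_p.
exists L, (horner_eval z \o map_poly (in_alg L)) => q /=; split; last first.
  by case/dvdpP=> r ->; rewrite /horner_eval rmorphM hornerM (rootP pz) mulr0.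
move=> qz; case: (boolP (p %| q)) => // npq.
have : coprimep p q.
  rewrite coprimep_def; case: irr_p => p1 irr.
  apply: contraNT npq => g1; have := irr _ g1 (dvdp_gcdl p q).
  by move/eqp_dvdl <-; apply: dvdp_gcdr.
rewrite -(coprimep_map (in_alg L)) => /coprimep_root /(_ pz).
by rewrite /= -/(horner_eval z _) qz eqxx.
Qed.

Definition coefs_dvd (R : idomainType) (n : nat) (d : {poly R}) (p : {mpoly {poly R}[n]}) :=
  forall m, d %| p@_m.

(* A root of [q] in an extension field turns reduction modulo [q] into a map to
   a domain, so irreducible elements of [F[x]] stay prime after adjoining variables. *)
Lemma coefs_dvd_prime (F : fieldType) (n : nat) (q : {poly F}) (f g : {mpoly {poly F}[n]}) :
  irreducible_poly q -> coefs_dvd q (f * g) -> coefs_dvd q f \/ coefs_dvd q g.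
Proof.
move=> /irreducible_poly_ker[L [h hE]] qfg.
have map0 p : map_mpoly h p = 0 -> coefs_dvd q p.
  by move=> p0 m; apply/hE; rewrite -mcoeff_map_mpoly p0 mcoeff0.
have: map_mpoly h (f * g) = 0.
  by apply/mpolyP=> m; rewrite mcoeff0 mcoeff_map_mpoly; apply/hE.
by rewrite rmorphM => /eqP; rewrite mulf_eq0 => /orP[]/eqP/map0; [left|right].
Qed.

Lemma coefs_dvdP (F : fieldType) (n : nat) (d : {poly F}) (p : {mpoly {poly F}[n]}) :
  coefs_dvd d p <-> exists q, p = d%:MP * q.
Proof.
split=> [dp|[q ->] m]; last by rewrite mcoeffCM dvdp_mulr.
exists (\sum_(m <- msupp p) (p@_m %/ d) *: 'X_[m]).
rewrite [LHS]mpolyE mulr_sumr; apply: eq_bigr => m _.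
by rewrite mul_mpolyC scalerA mulrC divpK.
Qed.

(** An irreducible factor [e] of [a] cannot divide all coefficients of [b], so by primality it
    divides those of [r]; cancelling [e] leaves the same equation with the smaller [a / e]. Without
    irreducible factors, [a] is a unit. *)
Lemma coefs_dvd_Gauss (F : fieldType) (n : nat) (a : {poly F}) (b q r : {mpoly {poly F}[n]}) :
    a != 0 -> (forall e, e %| a -> coefs_dvd e b -> (size e <= 1)%N) ->
  a%:MP * q = b * r -> coefs_dvd a r.
Proof.
have [s] := ubnP (size a); elim: s a q r => // s IH a q r; rewrite ltnS => le_as a0 cop.
move=> eq_aq m; apply: contraT => nar.
suff a1 : (size a <= 1)%N.
  have /eqp_dvdl Da : a %= 1 by rewrite -size_poly_eq1 eqn_leq a1 size_poly_gt0.
  by move: nar; rewrite Da dvd1p.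
apply: size_le1_no_irreducible => // e irr_e /dvdpP[c Da].
have ea : e %| a by rewrite Da dvdp_mull.
have e0 := irredp_neq0 irr_e; have c0 : c != 0 by apply: contraNneq a0; rewrite Da => ->;
  rewrite mul0r.
have [||/coefs_dvdP[r1 Dr]] := @coefs_dvd_prime _ _ e b r irr_e.
- by rewrite -eq_aq => m'; rewrite mcoeffCM dvdp_mulr.
- by move/(cop _ ea); rewrite leqNgt; case: irr_e => ->.
have: coefs_dvd c r1.
  apply: (IH c q r1) => // [|e' e'c|].
  - apply: leq_trans le_as; rewrite Da size_mul //.
    by have [+ _] := irr_e; case: (size e) => [|[|t]] // _; rewrite !addnS ltnS leq_addr.
  - by apply: cop; rewrite Da dvdp_mulr.
  apply: (@mulfI _ e%:MP); first by rewrite mpolyC_eq0.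
  by rewrite mulrA -mpolyCM mulrC [e * c]mulrC -Da mulrC eq_aq Dr mulrCA.
move/(_ m) => cr1; case/negP: nar; rewrite Dr Da mcoeffCM.
by rewrite mulrC dvdp_mul2l.
Qed.

(** * Substitutions and dependence on the first variables *)

Definition truncv (k : fieldType) (m : nat) : endo k :=
  [tuple if (i < m)%N then 'X_i else 0 | i < 4].

HB.instance Definition _ (k : fieldType) (s : endo k) :=
  GRing.RMorphism.copy (act s) (comp_mpoly s).

Lemma actC (k : fieldType) (s : endo k) c : act s c%:MP = c%:MP.
Proof. exact: comp_mpolyC. Qed.

Lemma actX (k : fieldType) (s : endo k) i : act s 'X_i = tnth s i.
Proof. by rewrite /act comp_mpolyXU -tnth_nth. Qed.

Lemma actZ (k : fieldType) (s : endo k) c p : act s (c *: p) = c *: act s p.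
Proof. exact: comp_mpolyZ. Qed.

Lemma act_ecomp (k : fieldType) (s t : endo k) p : act (ecomp s t) p = act s (act t p).
Proof.
apply: (@mpoly_rmorph_ext _ _ _ (act (ecomp s t)) (act s \o act t)) => [c|i] /=.
  by rewrite !actC.
by rewrite !actX tnth_mktuple.
Qed.

Lemma act_id (k : fieldType) (p : {mpoly k[4]}) : act (id_endo k) p = p.
Proof. exact: comp_mpoly_id. Qed.

Lemma act_inj (k : fieldType) (s t : endo k) : (forall p, act s p = act t p) -> s = t.
Proof. by move=> st; apply: eq_from_tnth => i; rewrite -!actX. Qed.

Lemma act_congr (k : fieldType) (s t : endo k) p : s = t -> act s p = act t p.
Proof. by move->. Qed.

Lemma ecompA (k : fieldType) (r s t : endo k) : ecomp r (ecomp s t) = ecomp (ecomp r s) t.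
Proof. by apply: act_inj => p; rewrite !act_ecomp. Qed.

Lemma ecomp_id (k : fieldType) (s : endo k) : ecomp s (id_endo k) = s.
Proof. by apply: act_inj => p; rewrite act_ecomp act_id. Qed.

Lemma id_ecomp (k : fieldType) (s : endo k) : ecomp (id_endo k) s = s.
Proof. by apply: act_inj => p; rewrite act_ecomp act_id. Qed.

Lemma in_vars_act_truncv (k : fieldType) m (p : {mpoly k[4]}) : in_vars m (act (truncv k m) p).
Proof.
elim/mpoly_ring_ind: p => [c|p q IHp IHq|i p IHp].
- rewrite actC => mon; rewrite msuppC; case: ifP => // _; rewrite inE => /eqP-> i _.
  by rewrite mnm0E.
- rewrite rmorphD => mon /msuppD_le; rewrite mem_cat => /orP[]; [exact: IHp|exact: IHq].
rewrite rmorphM /= actX tnth_mktuple; case: ltnP => im; last by rewrite mul0r => mon;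
  rewrite msupp0.
move=> mon; rewrite mulrC; move/msuppM_le/allpairsP => [[m1 m2] /= [/IHp H1]].
rewrite msuppX inE => /eqP-> -> j mj; rewrite mnmDE H1 // mnm1E.
by case: eqP => // ij; rewrite -ij leqNgt im in mj.
Qed.

(** A condition on supports becomes an equation between images of a ring morphism, so closure
    properties follow by rewriting. *)
Lemma in_varsP (k : fieldType) m (p : {mpoly k[4]}) : in_vars m p <-> act (truncv k m) p = p.
Proof.
split=> [mp|<-]; last exact: in_vars_act_truncv.
rewrite /act comp_mpolyE [RHS]mpolyE [LHS]big_seq [RHS]big_seq; apply: eq_bigr => mon /mp mon0.
congr (_ *: _); rewrite [RHS]mpolyXE_id; apply: eq_bigr => i _; rewrite tnth_mktuple.
by case: ltnP => // /mon0 ->; rewrite !expr0.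
Qed.

Lemma act_truncv_in_vars (k : fieldType) m n (p : {mpoly k[4]}) :
  (m <= n)%N -> in_vars m p -> act (truncv k n) p = p.
Proof. by move=> mn mp; apply/in_varsP => mon /mp mon0 i ni; apply/mon0/(leq_trans mn). Qed.

Lemma act_eq_in_vars (k : fieldType) m (s t : endo k) (p : {mpoly k[4]}) :
    (forall i : 'I_4, (i < m)%N -> tnth s i = tnth t i) -> in_vars m p ->
  act s p = act t p.
Proof.
move=> st /in_varsP <-; rewrite -!act_ecomp; apply: act_congr.
apply: eq_from_tnth => i; rewrite !tnth_mktuple; case: ltnP => im; last by rewrite !raddf0.
by rewrite !actX st.
Qed.

(** * The ring [k[x,y,z,w]] over [k[x]], and the gcd of form (iii) *)

Definition polyx (k : fieldType) : {poly k} -> {mpoly k[4]} :=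
  horner_eval (vx k) \o map_poly (@mpolyC 4 k).
HB.instance Definition _ (k : fieldType) :=
  GRing.RMorphism.copy (@polyx k) (horner_eval (vx k) \o map_poly (@mpolyC 4 k)).

(* k[x,y,z,w] as k[x][y,z,w]: the variable of index 0 of the target is not used. *)
Definition xcoef (k : fieldType) : {mpoly k[4]} -> {mpoly {poly k}[4]} :=
  mmap (@mpolyC 4 {poly k} \o polyC) (fun i => if i == 0 then 'X%:MP else 'X_i).
HB.instance Definition _ (k : fieldType) :=
  GRing.RMorphism.copy (@xcoef k)
    (mmap (@mpolyC 4 {poly k} \o polyC) (fun i => if i == 0 then 'X%:MP else 'X_i)).

(** Only a left inverse of [xcoef]: the constant ['X] and the idle variable of index 0 both go to
    x. *)
Definition xeval (k : fieldType) : {mpoly {poly k}[4]} -> {mpoly k[4]} :=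
  mmap (@polyx k) (fun i => 'X_i).
HB.instance Definition _ (k : fieldType) :=
  GRing.RMorphism.copy (@xeval k) (mmap (@polyx k) (fun i => 'X_i)).

Lemma polyxC (k : fieldType) (c : k) : polyx c%:P = c%:MP.
Proof. by rewrite /polyx /= /horner_eval map_polyC hornerC. Qed.

Lemma polyxX (k : fieldType) : polyx 'X = vx k.
Proof. by rewrite /polyx /= /horner_eval map_polyX hornerX. Qed.

Lemma xevalC (k : fieldType) (c : {poly k}) : xeval c%:MP = polyx c.
Proof. exact: mmapC. Qed.

Lemma xcoefC (k : fieldType) (c : k) : xcoef c%:MP = c%:P%:MP.
Proof. exact: mmapC. Qed.

Lemma xcoefX (k : fieldType) i :
    xcoef 'X_i = if i == 0 then 'X%:MP else 'X_i :> {mpoly {poly k}[4]}.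
Proof. by rewrite /xcoef mmapX mmap1U. Qed.

Lemma xcoefK (k : fieldType) : cancel (@xcoef k) (@xeval k).
Proof.
apply: (@mpoly_rmorph_ext _ _ _ (@xeval k \o @xcoef k) idfun) => [c|i] /=.
  by rewrite xcoefC xevalC polyxC.
rewrite xcoefX; case: eqP => [->|_]; first by rewrite xevalC polyxX.
by rewrite /xeval mmapX mmap1U.
Qed.

Lemma xcoef_polyx (k : fieldType) (c : {poly k}) : xcoef (polyx c) = c%:MP.
Proof.
elim/poly_ind: c => [|c a IH]; first by rewrite !rmorph0.
by rewrite !rmorphD !rmorphM /= IH polyxX polyxC xcoefC xcoefX.
Qed.

Lemma polyx_inj (k : fieldType) : injective (@polyx k).
Proof. by move=> c d /(congr1 (@xcoef k)); rewrite !xcoef_polyx => /(can_inj (@mpolyCK _ _)). Qed.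

Lemma polyx_in_vars (k : fieldType) (c : {poly k}) : in_vars 1 (polyx c).
Proof.
apply/in_varsP; elim/poly_ind: c => [|c a IH]; first by rewrite !rmorph0.
by rewrite !rmorphD !rmorphM /= IH polyxX polyxC actC actX tnth_mktuple.
Qed.

Lemma in_vars1P (k : fieldType) (p : {mpoly k[4]}) : in_vars 1 p -> exists c, p = polyx c.
Proof.
move/in_varsP <-; pose u := mmap polyC (fun i : 'I_4 => if i == 0 then 'X else 0) :
  {mpoly k[4]} -> _.
exists (u p); apply: (@mpoly_rmorph_ext _ _ _ (act _) (@polyx k \o u)) => [c|i] /=.
  by rewrite actC /u mmapC polyxC.
rewrite actX tnth_mktuple /u mmapX mmap1U ltnS leqn0 -[i == 0]/(val i == 0%N).
by case: eqP => [i0|_]; rewrite ?rmorph0 // polyxX; congr 'X_ _; apply: val_inj.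
Qed.

(** Over the domain [k[x]] degrees in the other variables add up, so a nonzero product of degree 0
    has factors of degree 0. *)
Lemma in_vars1_factor (k : fieldType) (p q : {mpoly k[4]}) :
  in_vars 1 (p * q) -> p * q != 0 -> in_vars 1 p.
Proof.
move=> /in_vars1P[c Dpq] pq0;
  have: xcoef p * xcoef q = c%:MP by rewrite -rmorphM /= Dpq xcoef_polyx.
have [p0 q0] : xcoef p != 0 /\ xcoef q != 0.
  by move: pq0; rewrite mulf_eq0 negb_or -2!(inj_eq (can_inj (@xcoefK k))) !rmorph0 => /andP[].
(* [msize] is the degree plus one, and 0 only for the zero polynomial; as neither factor is zero,
   both must have [msize] 1. *)
move/(congr1 (fun r : {mpoly _[4]} => msize r)); rewrite msizeM // msizeC => sz.
have /msize1_polyC Dp : (msize (xcoef p) <= 1)%N.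
  move: sz p0 q0; rewrite -!msize_poly_eq0 -!lt0n.
  case: (msize (xcoef p)) (msize (xcoef q)) => [|[|a]] [|b] //.
  by rewrite !addSn addnS; case: (c != 0).
by rewrite -[p]xcoefK Dp xevalC; apply: polyx_in_vars.
Qed.

Lemma in_vars_monotone (k : fieldType) m n (p : {mpoly k[4]}) :
    (m <= n)%N -> in_vars m p -> in_vars n p.
Proof. by move=> mn /(act_truncv_in_vars mn) /in_varsP. Qed.

Lemma in_vars_factor (k : fieldType) m (p q : {mpoly k[4]}) :
  in_vars m p -> p != 0 -> in_vars m (p * q) -> in_vars m q.
Proof.
move=> /in_varsP mp p0 /in_varsP; rewrite rmorphM /= mp => /(mulfI p0) mq.
exact/in_varsP.
Qed.

(* [d] is the gcd in k[x] of [alpha] and of the coefficients of [beta]. *)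
Lemma gcd_xy_exists (k : fieldType) (alpha beta : {mpoly k[4]}) :
    in_vars 1 alpha -> alpha != 0 -> in_vars 2 beta ->
  exists d a b, [/\ is_gcd_xy d alpha beta, alpha = d * a, beta = d * b, d != 0 &
    forall q r, a * q = b * r -> exists t, q = b * t /\ r = a * t].
Proof.
move=> /in_vars1P[al Dal] al0 vb.
have al0' : al != 0 by apply: contraNneq al0; rewrite Dal => ->; rewrite rmorph0.
(* Starting the fold at the nonzero [al] makes [g] nonzero even when [beta] is 0. *)
pose g := foldr (fun m => gcdp (xcoef beta)@_m) al (msupp (xcoef beta)).
have gE e : e %| g <-> e %| al /\ coefs_dvd e (xcoef beta).
  have -> : e %| g = (e %| al) && all (fun m => e %| (xcoef beta)@_m) (msupp (xcoef beta)).
    rewrite /g; elim: (msupp _) => [|m s IH] /=; first by rewrite andbT.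
    by rewrite dvdp_gcd IH andbCA.
  split=> [/andP[ea /allP eb]|[-> eb]]; last by apply/allP=> m _; apply: eb.
  split=> // m; have [/eb//|] := boolP (m \in msupp (xcoef beta)).
  by move/memN_msupp_eq0 ->; rewrite dvdp0.
have [/dvdpP[a0 Da] /coefs_dvdP[b0 Db]] := (gE g).1 (dvdpp g).
have g0 : g != 0 by apply: contraNneq al0' => g0; rewrite Da g0 mulr0.
have d0 : polyx g != 0 by rewrite -(rmorph0 (@polyx k)) (inj_eq (@polyx_inj k)).
have Dbeta : beta = polyx g * xeval b0 by rewrite -[LHS]xcoefK Db rmorphM /= xevalC.
have v2 c : in_vars 2 (@polyx k c) by move=> mon /polyx_in_vars mon0 i i2; apply: mon0; apply: ltnW.
have vb0 : in_vars 2 (xeval b0) by apply: in_vars_factor (v2 g) d0 _; rewrite -Dbeta.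
have Dalpha : alpha = polyx g * polyx a0 by rewrite -rmorphM mulrC -Da.
exists (polyx g), (polyx a0), (xeval b0); split=> //.
  split=> //; [by exists (polyx a0)|by exists (xeval b0)|].
  move=> e ve [q [vq Dq]] [r [vr Dr]].
  (* A divisor of the nonzero [alpha] lies in [k[x]], so the common divisors in [k[x,y]] are those
     that [gE] describes. *)
  have /in_vars1P[e1 De] : in_vars 1 e.
    by apply: (@in_vars1_factor _ e q); rewrite -Dq // Dal; apply: polyx_in_vars.
  have : e1 %| g.
    apply/gE; split; last first.
      by apply/coefs_dvdP; exists (xcoef r); rewrite Dr De rmorphM /= xcoef_polyx.
    have /in_vars1P[q1 Dq1] : in_vars 1 q.
      by apply: (@in_vars1_factor _ q e); rewrite mulrC -Dq // Dal; apply: polyx_in_vars.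
    suff -> : al = q1 * e1 by apply: dvdp_mull.
    by apply: (@polyx_inj k); rewrite -Dal Dq De Dq1 rmorphM mulrC.
  by case/dvdpP=> c ->; exists (polyx c); split=> //; rewrite De rmorphM mulrC.
have a00 : a0 != 0 by apply: contraNneq al0' => a00; rewrite Da a00 mul0r.
have pa0 : polyx a0 != 0 by rewrite -(rmorph0 (@polyx k)) (inj_eq (@polyx_inj k)).
(* [xeval] is not injective, so this comes from [Db] by cancelling [g]. *)
have b0E : xcoef (xeval b0) = b0.
  apply: (@mulfI _ g%:MP); first by rewrite mpolyC_eq0.
  by rewrite -Db -xcoef_polyx -rmorphM -Dbeta.
move=> q r eq_qr.
have /coefs_dvdP[t Dt] : coefs_dvd a0 (xcoef r).
  apply: (@coefs_dvd_Gauss _ _ a0 b0 (xcoef q) _ a00).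
    (* A common divisor [e] of [a0] and the coefficients of [b0] makes [e * g] divide [g]; comparing
       sizes leaves [e] constant. *)
    move=> e ea eb; have: e * g %| g.
      apply/gE; split=> [|m]; first by rewrite Da dvdp_mul2r.
      by rewrite Db mcoeffCM [g * _]mulrC dvdp_mul2r.
    move/(dvdp_leq g0); rewrite size_mul //; last by apply: contraNneq a00 => e0;
      rewrite -dvd0p -e0.
    case: (size e) => [|[|s]] //; rewrite !addSn /= -ltnS => H.
    by move: H; rewrite ltnNge ltnS leq_addl.
  by rewrite -xcoef_polyx -rmorphM eq_qr rmorphM /= b0E.
have Dr : r = polyx a0 * xeval t by rewrite -[LHS]xcoefK Dt rmorphM /= xevalC.
exists (xeval t); split=> //; apply: (mulfI pa0).
by rewrite eq_qr Dr mulrCA.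
Qed.

(** * Polynomials in one distinguished variable *)

(** Coefficients are kept in the whole ring, although ['X_i] does not occur in them, so that
    evaluation at ['X_i] gives the polynomial back. *)
Definition uni_var (k : fieldType) (i : 'I_4) : {mpoly k[4]} -> {poly {mpoly k[4]}} :=
  mmap (@polyC _ \o @mpolyC 4 k) (fun j => if j == i then 'X else ('X_j)%:P).
HB.instance Definition _ (k : fieldType) (i : 'I_4) :=
  GRing.RMorphism.copy (@uni_var k i)
    (mmap (@polyC _ \o @mpolyC 4 k) (fun j => if j == i then 'X else ('X_j)%:P)).

Lemma uni_varC (k : fieldType) i (c : k) : uni_var i c%:MP = c%:MP%:P.
Proof. exact: mmapC. Qed.

Lemma uni_varX (k : fieldType) i j :
  uni_var i 'X_j = if j == i then 'X else ('X_j)%:P :> {poly {mpoly k[4]}}.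
Proof. by rewrite /uni_var mmapX mmap1U. Qed.

Lemma uni_varK (k : fieldType) i (p : {mpoly k[4]}) : (uni_var i p).['X_i] = p.
Proof.
apply: (@mpoly_rmorph_ext _ _ _ (horner_eval 'X_i \o @uni_var k i) idfun) => [c|j] /=.
  by rewrite /horner_eval uni_varC hornerC.
by rewrite /horner_eval uni_varX; case: eqP => [->|_]; rewrite ?hornerX ?hornerC.
Qed.

Lemma uni_var_in_vars (k : fieldType) m (i : 'I_4) (p : {mpoly k[4]}) :
  (m <= i)%N -> in_vars m p -> uni_var i p = p%:P.
Proof.
move=> mi /in_varsP <-.
apply: (@mpoly_rmorph_ext _ _ _ (@uni_var k i \o act (truncv k m))
  (@polyC _ \o act (truncv k m))) => [c|j] /=.
  by rewrite !actC uni_varC.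
rewrite !actX !tnth_mktuple; case: ltnP => jm; last by rewrite !rmorph0.
by rewrite uni_varX; case: eqP => // ji; rewrite -ji leqNgt jm in mi.
Qed.

(* For [c] nonzero and free of [X_i], the image of [act (ASsub i c)] is the ring of
   invariants of the Artin-Schreier translation X_i |-> X_i + c. *)
Definition ASsub (k : fieldType) (i : 'I_4) (c : {mpoly k[4]}) : endo k :=
  [tuple if j == i then 'X_i ^+ 2 + c * 'X_i else 'X_j | j < 4].

(** Seen in the variable ['X_i], the substitution is composition with [h], which is injective
    because [h] has degree 2. *)
Lemma act_ASsub_inj (k : fieldType) m (i : 'I_4) (c : {mpoly k[4]}) :
  (m <= i)%N -> in_vars m c -> injective (act (ASsub i c)).
Proof.
move=> mi mc; pose h : {poly {mpoly k[4]}} := 'X^2 + c%:P * 'X.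
have comm p : uni_var i (act (ASsub i c) p) = uni_var i p \Po h.
  apply: (@mpoly_rmorph_ext _ _ _ (@uni_var k i \o act (ASsub i c))
    (comp_poly h \o @uni_var k i)) => [a|j] /=.
    by rewrite actC uni_varC comp_polyC.
  rewrite actX tnth_mktuple uni_varX; case: eqP => [_|/eqP nji]; last first.
    by rewrite uni_varX (negPf nji) comp_polyC.
  by rewrite rmorphD rmorphM rmorphXn /= (uni_var_in_vars mi mc) uni_varX eqxx comp_polyX.
have sh : (1 < size h)%N.
  rewrite /h size_polyDl ?size_polyXn // ltnS.
  by rewrite mul_polyC (leq_trans (size_scale_leq _ _)) ?size_polyX.
move=> p q /(congr1 (@uni_var k i)); rewrite !comm => /eqP; rewrite -subr_eq0 -rmorphB /=.
rewrite comp_poly_eq0 // subr_eq0 => /eqP.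
by move=> pq; rewrite -[p](uni_varK i) pq uni_varK.
Qed.

(** * Characteristic two and explicit quadruples *)

Lemma addpp (k : fieldType) (hk : 2%N \in [pchar k]) (p : {mpoly k[4]}) : p + p = 0.
Proof. by rewrite -mulr2n -scaler_nat (pcharf0 hk) scale0r. Qed.

(** [ring] does not use the characteristic, so the terms that occur twice are supplied as [r]. *)
Lemma eq_mod2 (k : fieldType) (hk : 2%N \in [pchar k]) (r p q : {mpoly k[4]}) :
  p = q + (r + r) -> p = q.
Proof. by rewrite addpp // addr0. Qed.

Lemma addp_eq0 (k : fieldType) (hk : 2%N \in [pchar k]) (p q : {mpoly k[4]}) : p + q = 0 -> p = q.
Proof. by move/(congr1 (+%R^~ q)); rewrite -addrA addpp // addr0 add0r. Qed.

Lemma ord4_ind (Q : 'I_4 -> Prop) : Q 0 -> Q 1 -> Q 2 -> Q 3 -> forall i, Q i.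
Proof.
move=> Q0 Q1 Q2 Q3 [[|[|[|[|]]]] //= lt_i4].
- by rewrite (_ : Ordinal _ = 0) //; apply: val_inj.
- by rewrite (_ : Ordinal _ = 1) //; apply: val_inj.
- by rewrite (_ : Ordinal _ = 2) //; apply: val_inj.
by rewrite (_ : Ordinal _ = 3) //; apply: val_inj.
Qed.

Lemma endo_eq (k : fieldType) (s t : endo k) :
  tnth s 0 = tnth t 0 -> tnth s 1 = tnth t 1 -> tnth s 2 = tnth t 2 -> tnth s 3 = tnth t 3 ->
  s = t.
Proof. by move=> *; apply: eq_from_tnth; apply: ord4_ind. Qed.

Lemma tnth_mk4 (k : fieldType) (a b c d : {mpoly k[4]}) :
  (tnth (mk4 a b c d) 0 = a) * (tnth (mk4 a b c d) 1 = b) *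
  (tnth (mk4 a b c d) 2 = c) * (tnth (mk4 a b c d) 3 = d).
Proof. by split; rewrite // !(tnth_nth 0). Qed.

Lemma act_mk4 (k : fieldType) (a b c d : {mpoly k[4]}) :
  (act (mk4 a b c d) (vx k) = a) * (act (mk4 a b c d) (vy k) = b) *
  (act (mk4 a b c d) (vz k) = c) * (act (mk4 a b c d) (vw k) = d).
Proof. by rewrite !actX !tnth_mk4. Qed.

Lemma ecomp_mk4 (k : fieldType) (s : endo k) (a b c d : {mpoly k[4]}) :
  ecomp s (mk4 a b c d) = mk4 (act s a) (act s b) (act s c) (act s d).
Proof. by apply: endo_eq; rewrite tnth_mktuple !tnth_mk4. Qed.

Lemma id_endo_mk4 (k : fieldType) : id_endo k = mk4 (vx k) (vy k) (vz k) (vw k).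
Proof. by apply: endo_eq; rewrite tnth_mktuple tnth_mk4. Qed.

Lemma truncv3_mk4 (k : fieldType) : truncv k 3 = mk4 (vx k) (vy k) (vz k) 0.
Proof. by apply: endo_eq; rewrite tnth_mktuple tnth_mk4. Qed.

Lemma act_mk4_in_vars1 (k : fieldType) (a b c d b' c' d' p : {mpoly k[4]}) :
  in_vars 1 p -> act (mk4 a b c d) p = act (mk4 a b' c' d') p.
Proof. by apply: act_eq_in_vars; apply: ord4_ind; rewrite // !tnth_mk4. Qed.

Lemma act_mk4_in_vars2 (k : fieldType) (a b c d c' d' p : {mpoly k[4]}) :
  in_vars 2 p -> act (mk4 a b c d) p = act (mk4 a b c' d') p.
Proof. by apply: act_eq_in_vars; apply: ord4_ind; rewrite // !tnth_mk4. Qed.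

Lemma act_mk4_in_vars3 (k : fieldType) (a b c d d' p : {mpoly k[4]}) :
  in_vars 3 p -> act (mk4 a b c d) p = act (mk4 a b c d') p.
Proof. by apply: act_eq_in_vars; apply: ord4_ind; rewrite // !tnth_mk4. Qed.

Lemma act_fix1 (k : fieldType) (b c d p : {mpoly k[4]}) :
    in_vars 1 p -> act (mk4 (vx k) b c d) p = p.
Proof. move/(@act_mk4_in_vars1 _ _ _ _ _ (vy k) (vz k) (vw k))->;
  by rewrite -id_endo_mk4 act_id. Qed.

Lemma act_fix2 (k : fieldType) (c d p : {mpoly k[4]}) : in_vars 2 p -> act (mk4 (vx k)
    (vy k) c d) p = p.
Proof. move/(@act_mk4_in_vars2 _ _ _ _ _ (vz k) (vw k))->; by rewrite -id_endo_mk4 act_id. Qed.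

Lemma act_fix3 (k : fieldType) (d p : {mpoly k[4]}) : in_vars 3 p -> act (mk4 (vx k) (vy k)
    (vz k) d) p = p.
Proof. move/(@act_mk4_in_vars3 _ _ _ _ _ (vw k))->; by rewrite -id_endo_mk4 act_id. Qed.

(** * Invariants of a translation of one variable *)

Definition shiftv (k : fieldType) (i : 'I_4) (c : {mpoly k[4]}) : endo k :=
  [tuple if j == i then 'X_i + c else 'X_j | j < 4].

Lemma ASsub1_mk4 (k : fieldType) (c : {mpoly k[4]}) :
  ASsub 1 c = mk4 (vx k) (vy k ^+ 2 + c * vy k) (vz k) (vw k).
Proof. by apply: endo_eq; rewrite tnth_mktuple tnth_mk4. Qed.

Lemma ASsub2_mk4 (k : fieldType) (c : {mpoly k[4]}) :
  ASsub 2 c = mk4 (vx k) (vy k) (vz k ^+ 2 + c * vz k) (vw k).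
Proof. by apply: endo_eq; rewrite tnth_mktuple tnth_mk4. Qed.

Lemma shiftv1_mk4 (k : fieldType) (c : {mpoly k[4]}) :
  shiftv 1 c = mk4 (vx k) (vy k + c) (vz k) (vw k).
Proof. by apply: endo_eq; rewrite tnth_mktuple tnth_mk4. Qed.

Lemma shiftv2_mk4 (k : fieldType) (c : {mpoly k[4]}) :
  shiftv 2 c = mk4 (vx k) (vy k) (vz k + c) (vw k).
Proof. by apply: endo_eq; rewrite tnth_mktuple tnth_mk4. Qed.

Lemma act_off_var (k : fieldType) m (i : 'I_4) (s : endo k) (p : {mpoly k[4]}) :
  (forall j, j != i -> tnth s j = 'X_j) -> (m <= i)%N -> in_vars m p -> act s p = p.
Proof.
move=> sX mi mp; rewrite -[RHS]act_id; apply: act_eq_in_vars mp => j jm.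
rewrite [RHS]tnth_mktuple sX //; apply: contraTneq jm => ->; by rewrite -leqNgt.
Qed.

Lemma act_ASsub_fix (k : fieldType) m (i : 'I_4) (c p : {mpoly k[4]}) :
  (m <= i)%N -> in_vars m p -> act (ASsub i c) p = p.
Proof. by apply: act_off_var => j /negPf ji; rewrite tnth_mktuple ji. Qed.

Lemma act_shiftv_fix (k : fieldType) m (i : 'I_4) (c p : {mpoly k[4]}) :
  (m <= i)%N -> in_vars m p -> act (shiftv i c) p = p.
Proof. by apply: act_off_var => j /negPf ji; rewrite tnth_mktuple ji. Qed.

(** Such sums are stable under multiplication by ['X_i], since in characteristic two ['X_i ^+ 2] is
    the substituted polynomial plus [c * 'X_i]. *)
Lemma ASsub_decomp (k : fieldType) (hk : 2%N \in [pchar k]) m (i : 'I_4) (c p : {mpoly k[4]}) :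
    (m <= i)%N -> in_vars m c ->
  exists q r, p = act (ASsub i c) q + 'X_i * act (ASsub i c) r.
Proof.
move=> mi mc; have Gc := act_ASsub_fix c mi mc.
elim/mpoly_ring_ind: p => [a|p1 p2 [q1 [r1 ->]] [q2 [r2 ->]]|j p [q [r ->]]].
- by exists a%:MP, 0; rewrite actC raddf0 mulr0 addr0.
- by exists (q1 + q2), (r1 + r2); rewrite !rmorphD /=; ring.
have [->|ji] := eqVneq j i.
  exists ('X_i * r), (q + c * r); rewrite rmorphD !rmorphM /= actX tnth_mktuple eqxx Gc.
  apply: (@eq_mod2 _ hk (- (c * 'X_i * act (ASsub i c) r))); ring.
exists ('X_j * q), ('X_j * r); rewrite !rmorphM /= actX tnth_mktuple (negPf ji); ring.
Qed.

Lemma shiftv_ASsub (k : fieldType) (hk : 2%N \in [pchar k]) m (i : 'I_4) (c : {mpoly k[4]}) :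
  (m <= i)%N -> in_vars m c -> ecomp (shiftv i c) (ASsub i c) = ASsub i c.
Proof.
move=> mi mc; apply: eq_from_tnth => j; rewrite !tnth_mktuple.
case: eqP => [_|/eqP/negPf ji]; last by rewrite actX tnth_mktuple ji.
rewrite rmorphD rmorphM rmorphXn /= (act_shiftv_fix c mi mc) actX tnth_mktuple eqxx.
by apply: (@eq_mod2 _ hk (c * 'X_i + c ^+ 2)); ring.
Qed.

Lemma ASsub_truncv (k : fieldType) m n (i : 'I_4) (c : {mpoly k[4]}) :
    (m <= i < n)%N -> in_vars m c ->
  ecomp (truncv k n) (ASsub i c) = ecomp (ASsub i c) (truncv k n).
Proof.
case/andP=> mi i_n mc; apply: eq_from_tnth => j; rewrite !tnth_mktuple.
case: eqP => [->|/eqP/negPf ji].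
  rewrite i_n actX !tnth_mktuple eqxx rmorphD rmorphM rmorphXn /= actX tnth_mktuple i_n.
  by rewrite (act_truncv_in_vars _ mc) // (leq_trans mi) // ltnW.
rewrite actX tnth_mktuple; case: ifP => _; last by rewrite raddf0.
by rewrite actX tnth_mktuple ji.
Qed.

(** The translation adds to [p] the product of [c] and the second component of [ASsub_decomp], so
    that component vanishes. *)
Lemma shiftv_invariant (k : fieldType) (hk : 2%N \in [pchar k]) m n (i : 'I_4) (c p :
    {mpoly k[4]}) :
    (m <= i < n)%N -> in_vars m c -> c != 0 -> in_vars n p -> act (shiftv i c) p = p ->
  exists q, in_vars n q /\ p = act (ASsub i c) q.
Proof.
move=> min mc c0 np; have mi : (m <= i)%N by case/andP: min.
have [q [r Dp]] := ASsub_decomp hk p mi mc; rewrite {1 2}Dp.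
rewrite rmorphD rmorphM /= -!act_ecomp (shiftv_ASsub hk mi mc) actX tnth_mktuple eqxx.
move/addrI; rewrite mulrDl -[RHS]addr0 => /addrI/eqP; rewrite mulf_eq0 (negPf c0) /= => /eqP r0.
(* [q] may involve variables of index [n] or more; truncation removes them and leaves [p]
   unchanged. *)
exists (act (truncv k n) q); split; first exact: in_vars_act_truncv.
rewrite -act_ecomp -(ASsub_truncv min mc) act_ecomp; move/in_varsP: np => {1}<-;
  by rewrite {1}Dp r0 mulr0 addr0.
Qed.

(** * Form (iii): invariance and generation *)

(** Although the gcd is taken in [k[x,y]], [d] and [a] divide the nonzero [alpha] and so lie in
    [k[x]]. *)
Lemma gcd_xy_in_vars (k : fieldType) (alpha beta d a b : {mpoly k[4]}) :
    in_vars 1 alpha -> alpha != 0 -> in_vars 2 beta -> is_gcd_xy d alpha beta ->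
    alpha = d * a -> beta = d * b ->
  [/\ in_vars 1 d, in_vars 1 a & in_vars 2 b].
Proof.
move=> va a0 vb [vd _ _ _] Da Db; have [d1 a1] : in_vars 1 d /\ in_vars 1 a.
  by split; [apply: (@in_vars1_factor _ d a)|apply: (@in_vars1_factor _ a d)];
     rewrite ?[a * d]mulrC -Da.
split=> //; apply: in_vars_factor vd _ _; last by rewrite -Db.
by apply: contraNneq a0 => d0; rewrite Da d0 mul0r.
Qed.

(* f1, ..., f4 of form (iii), with [beta'] and [b'] for [beta] and [b] at (x, f2). *)
Definition gens_iii (k : fieldType) (alpha beta' a b' : {mpoly k[4]}) : endo k :=
  mk4 (vx k) (vy k ^+ 2 + alpha * vy k) (vz k ^+ 2 + beta' * vz k) (a * vz k + b' * vy k).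

Lemma act_y_in_vars2 (k : fieldType) (q p : {mpoly k[4]}) c d :
  in_vars 2 q -> in_vars 2 p -> in_vars 2 (act (mk4 (vx k) q c d) p).
Proof.
move=> /in_varsP vq /in_varsP vp; apply/in_varsP.
rewrite -vp -!act_ecomp; apply: act_congr.
apply: endo_eq; rewrite !tnth_mktuple /= ?raddf0 ?actX //= ?tnth_mk4 //.
  by rewrite tnth_mktuple tnth_mk4 actX tnth_mktuple.
by rewrite tnth_mktuple tnth_mk4.
Qed.

(** The increment of f4 is [a * beta' + b' * alpha], which is twice [a * d * b']. The image [g] of w
    is left open to cover both [T] and the map fixing w. *)
Lemma gens_iii_invariant (k : fieldType) (hk : 2%N \in [pchar k]) (alpha beta d a b g :
    {mpoly k[4]}) :
    in_vars 1 alpha -> in_vars 2 beta -> in_vars 1 d -> in_vars 1 a -> in_vars 2 b ->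
    alpha = d * a -> beta = d * b ->
  let f2 := vy k ^+ 2 + alpha * vy k in
  let beta' := act (mk4 (vx k) f2 (vz k) (vw k)) beta in
  let b' := act (mk4 (vx k) f2 (vz k) (vw k)) b in
  let F := gens_iii alpha beta' a b' in
  let s := mk4 (vx k) (vy k + alpha) (vz k + beta') g in
  act s beta' = beta' /\ ecomp s F = F.
Proof.
move=> va vb vd v1a v2b Da Db f2 beta' b' F s.
have sf2 : act s f2 = f2.
  rewrite /f2 rmorphD rmorphM rmorphXn /= !act_mk4 act_fix1 //.
  by apply: (@eq_mod2 _ hk (alpha * vy k + alpha ^+ 2)); ring.
have sfix p : in_vars 2 p -> act s (act (mk4 (vx k) f2 (vz k)
  (vw k)) p) = act (mk4 (vx k) f2 (vz k) (vw k)) p.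
  by move=> vp; rewrite -act_ecomp ecomp_mk4 sf2 act_mk4; apply: act_mk4_in_vars2.
have Db' : beta' = d * b' by rewrite /beta' Db rmorphM /= act_fix1.
split; first exact: sfix.
rewrite /F /gens_iii ecomp_mk4 sf2 act_mk4; congr mk4.
  rewrite rmorphD rmorphM rmorphXn /= !act_mk4 sfix //.
  by apply: (@eq_mod2 _ hk (beta' * vz k + beta' ^+ 2)); ring.
rewrite rmorphD !rmorphM /= !act_mk4 sfix // -/b' act_fix1 // Db' Da.
by apply: (@eq_mod2 _ hk (a * d * b')); ring.
Qed.

(** [T] adds to each variable an element that it fixes, so applying it twice adds that element
    twice. *)
Lemma of_forms_involution (k : fieldType) (hk : 2%N \in [pchar k]) (T : endo k) :
  of_forms T -> involution T.
Proof.
rewrite /involution id_endo_mk4; case=> [[f [vf ->]]|[[xi [eta [vxi xi0 veta ->]]]|]].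
- rewrite ecomp_mk4 !act_mk4 rmorphD /= !act_mk4 act_fix3 //; congr mk4.
  by rewrite -addrA addpp // addr0.
- set s := mk4 _ _ _ _; have sxi : act s xi = xi by apply: act_fix2.
  rewrite ecomp_mk4 !act_mk4 !rmorphD /= !act_mk4.
  rewrite -act_ecomp ecomp_mk4 /= rmorphD rmorphM rmorphXn /= !act_mk4 sxi.
  congr mk4; first by rewrite -addrA addpp // addr0.
  rewrite (_ : (vz k + xi) ^+ 2 + xi * (vz k + xi) = vz k ^+ 2 + xi * vz k); last first.
    by apply: (@eq_mod2 _ hk (xi * vz k + xi ^+ 2)); ring.
  by rewrite (act_mk4_in_vars3 _ _ _ _ (vw k) veta) -addrA addpp // addr0.
case=> alpha [beta [gamma [d [a [b [va a0 vb b0 [gd Da Db]]]]]]] /=.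
have [v1d v1a v2b] := gcd_xy_in_vars va a0 vb gd Da Db.
rewrite act_fix1 //.
set f2 := vy k ^+ 2 + _; set beta' := act _ beta; set b' := act _ b.
set F := mk4 _ f2 _ _ => ->; set s := mk4 _ _ _ _.
have [sb sF] := @gens_iii_invariant _ hk alpha beta d a b (vw k + act F gamma) va vb v1d v1a v2b Da Db.
rewrite ecomp_mk4 !rmorphD /= !act_mk4 -act_ecomp sF sb (act_fix1 _ _ _ va).
by congr mk4; rewrite -addrA addpp // addr0.
Qed.

Lemma gens_iii_generate (k : fieldType) (hk : 2%N \in [pchar k]) (alpha beta phi : {mpoly k[4]}) :
    in_vars 1 alpha -> alpha != 0 -> in_vars 2 beta -> beta != 0 -> in_vars 3 phi ->
  let f2 := vy k ^+ 2 + alpha * vy k in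
  let beta' := act (mk4 (vx k) f2 (vz k) (vw k)) beta in
    act (mk4 (vx k) (vy k + alpha) (vz k + beta') (vw k)) phi = phi ->
  exists d a b gamma, [/\ is_gcd_xy d alpha beta, alpha = d * a, beta = d * b &
    phi = act (gens_iii alpha beta' a (act (mk4 (vx k) f2 (vz k) (vw k)) b)) gamma].
Proof.
move=> va a0 vb b0 vphi f2 beta'.
(* Three identities: the change of a combination of 1, y, z, yz under the shift; the change of that
   result when y alone is shifted; the regrouping around f4. *)
have shift_diff (A B y z u0 u1 v0 v1 : {mpoly k[4]}) :
    A * u1 + B * v0 + (y * B + A * z + A * B) * v1 =
    u0 + (y + A) * u1 + (z + B) * (v0 + (y + A) * v1) - (u0 + y * u1 + z * (v0 + y * v1)).
  by ring.
have shift_diff2 (A B y z u v0 v1 : {mpoly k[4]}) :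
    A * u + B * v0 + ((y + A) * B + A * z + A * B) * v1
      - (A * u + B * v0 + (y * B + A * z + A * B) * v1) = A * B * v1.
  by ring.
have collect (A B y z u v : {mpoly k[4]}) :
    u + y * (B * v) + z * (A * v + y * 0) = u + (A * z + B * y) * v.
  by ring.
have [d [a [b [gd Da Db d0 coprime_ab]]]] := gcd_xy_exists va a0 vb.
have [v1d v1a v2b] := gcd_xy_in_vars va a0 vb gd Da Db.
pose b' := act (mk4 (vx k) f2 (vz k) (vw k)) b; pose F := gens_iii alpha beta' a b'.
have vf2 : in_vars 2 f2.
  have va2 : in_vars 2 alpha := @in_vars_monotone k 1 2 alpha isT va.
  by apply/in_varsP; rewrite /f2 rmorphD rmorphM rmorphXn /= actX tnth_mktuple
     ((in_varsP 2 alpha).1 va2).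
have vb' : in_vars 2 beta' by apply: act_y_in_vars2.
have vb'2 : in_vars 2 b' by apply: act_y_in_vars2.
(* [G] substitutes f2 for y and f3 for z; as a composite of two Artin-Schreier substitutions it is
   injective. *)
pose G2 := ASsub 1 alpha; pose H := ASsub 2 beta'; pose G := ecomp H G2.
have injG2 : injective (act G2) := @act_ASsub_inj k 1 1 alpha isT va.
have injH : injective (act H) := @act_ASsub_inj k 2 2 beta' isT vb'.
have injG : injective (act G) by move=> p q; rewrite !act_ecomp => /injH/injG2.
have G2E : G2 = mk4 (vx k) f2 (vz k) (vw k) by apply: ASsub1_mk4.
have Hfix p : in_vars 2 p -> act H p = p by rewrite /H ASsub2_mk4; apply: act_fix2.
have b'0 : beta' != 0 by rewrite /beta' -G2E -(raddf0 (act G2)) (inj_eq injG2).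
pose f3 := vz k ^+ 2 + beta' * vz k.
have GE : G = mk4 (vx k) f2 f3 (vw k).
  by rewrite /G G2E ecomp_mk4 (Hfix f2) // /H ASsub2_mk4 !act_mk4.
set s := mk4 _ _ _ _ => s_phi.
have [sb sF] := @gens_iii_invariant _ hk alpha beta d a b (vw k) va vb v1d v1a v2b Da Db.
have sG p : act s (act G p) = act G p.
  move: sF; rewrite /F /gens_iii ecomp_mk4 -act_ecomp GE ecomp_mk4 act_mk4.
  move/(congr1 (fun u => (tnth u 1, tnth u 2))); rewrite !tnth_mk4.
  by case=> -> ->; rewrite act_mk4.
(* [s1] moves y alone and still fixes the image of [G], as [beta'] is invariant under it; it will
   isolate the coefficient of yz. *)
pose s1 := mk4 (vx k) (vy k + alpha) (vz k) (vw k).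
have s1b : act s1 beta' = beta'.
  by rewrite -[RHS]sb; apply: act_mk4_in_vars2.
have s1G p : act s1 (act G p) = act G p.
  rewrite -act_ecomp; apply: act_congr; rewrite GE ecomp_mk4 !act_mk4; congr mk4.
    rewrite -[RHS](_ : act s f2 = f2); first exact: act_mk4_in_vars2.
    by move: (sG (vy k)); rewrite GE act_mk4.
  by rewrite rmorphD rmorphM rmorphXn /= s1b act_mk4.
(* Splitting along z, then each component along y, gives the coefficients of 1, y, z and yz. *)
have [p [q Dphi]] := @ASsub_decomp k hk 2 2 beta' phi isT vb'.
have [p0 [p1 Dp]] := @ASsub_decomp k hk 1 1 alpha p isT va.
have [q0 [q1 Dq]] := @ASsub_decomp k hk 1 1 alpha q isT va.
have Hy : act H (vy k) = vy k by rewrite /H ASsub2_mk4 act_mk4.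
have {Dphi} Dphi : phi = act G p0 + vy k * act G p1 + vz k * (act G q0 + vy k * act G q1).
  by rewrite Dphi Dp Dq !rmorphD !rmorphM /= -/(vy k) Hy !act_ecomp.
have E : alpha * act G p1 + beta' * act G q0 +
    (vy k * beta' + alpha * vz k + alpha * beta') * act G q1 = 0.
  move: s_phi => /eqP; rewrite -subr_eq0 Dphi !rmorphD !rmorphM !rmorphD !rmorphM /=.
  by rewrite !sG !act_mk4 => /eqP <-; apply: shift_diff.
(* The left side of [E] and its image under [s1] differ by [alpha * beta' * act G q1]. *)
have q10 : act G q1 = 0.
  move: (congr1 (act s1) E); rewrite raddf0 -[RHS]E !rmorphD !rmorphM !rmorphD !rmorphM /=.
  rewrite !s1G !act_mk4 s1b (act_fix1 _ _ _ va) => /eqP; rewrite -subr_eq0.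
  rewrite (_ : _ - _ = alpha * beta' * act G q1); last exact: shift_diff2.
  by rewrite !mulf_eq0 (negPf a0) (negPf b'0) => /eqP.
have Gfix1 u : in_vars 1 u -> act G u = u by rewrite GE; apply: act_fix1.
have Gb u : in_vars 2 u -> act G u = act (mk4 (vx k) f2 (vz k) (vw k)) u.
  by rewrite GE; apply: act_mk4_in_vars2.
(* With [q1] gone, [E] is the image under [G] of an equality between [alpha * p1] and [beta * q0];
   [G] is injective and [d] cancels. *)
have [t [Dp1 Dq0]] : exists t, p1 = b * t /\ q0 = a * t.
  apply: coprime_ab; apply: (mulfI d0); rewrite !mulrA -Da -Db; apply: injG.
  rewrite !rmorphM /= (Gfix1 _ va) (Gb _ vb); apply: (addp_eq0 hk).
  by move: E; rewrite q10 mulr0 addr0.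
(* The last slot of [F] is f4, so w must occur in the witness only where f4 is meant: [p0] and [t]
   are truncated, which [phi], free of w, permits. *)
exists d, a, b, (act (truncv k 3) p0 + vw k * act (truncv k 3) t); split=> //.
have tG u : act (truncv k 3) (act G u) = act F (act (truncv k 3) u).
  rewrite -!act_ecomp; apply: act_congr; rewrite truncv3_mk4 GE !ecomp_mk4 !act_mk4.
  rewrite raddf0; congr mk4; first by rewrite act_fix3 //; apply: (@in_vars_monotone k 2).
  by rewrite rmorphD rmorphM rmorphXn /= !act_mk4 act_fix2.
have Gbt : act G (b * t) = b' * act G t by rewrite rmorphM /= Gb.
have Gat : act G (a * t) = a * act G t by rewrite rmorphM /= Gfix1.
have {}Dphi : phi = act G p0 + (a * vz k + b' * vy k) * act G t.
  by rewrite Dphi q10 Dp1 Dq0 Gbt Gat; apply: collect.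
rewrite -[LHS]((in_varsP 3 phi).1 vphi) Dphi !rmorphD !rmorphM /= -!tG act_mk4.
congr (_ + _ * _); rewrite truncv3_mk4 rmorphD !rmorphM /= !act_mk4.
by rewrite (act_fix1 _ _ _ v1a) (act_fix2 _ _ vb'2).
Qed.

(** * Conjugation and the shape of triangular involutions *)

Lemma involution_is_aut (k : fieldType) (s : endo k) : involution s -> is_aut s.
Proof. by exists s. Qed.

Lemma is_aut_ecomp (k : fieldType) (s t : endo k) : is_aut s -> is_aut t -> is_aut (ecomp s t).
Proof.
move=> [s' [ss' s's]] [t' [tt' t't]]; exists (ecomp t' s').
by rewrite !ecompA -[ecomp (ecomp s t) t']ecompA tt' ecomp_id -[ecomp (ecomp t' s') s]ecompA
  s's ecomp_id.
Qed.

Lemma involution_conj (k : fieldType) (phi psi T : endo k) :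
  ecomp psi phi = id_endo k -> ecomp phi psi = id_endo k -> involution T ->
  involution (ecomp phi (ecomp T psi)).
Proof.
move=> psiphi phipsi TT; apply: act_inj => p; rewrite !act_ecomp.
have -> q : act psi (act phi q) = q by rewrite -act_ecomp psiphi act_id.
have -> q : act T (act T q) = q by rewrite -act_ecomp TT act_id.
by rewrite -act_ecomp phipsi.
Qed.

(** Checking an intertwining relation avoids computing the inverse of [phi]. *)
Lemma conj_of_intertwine (k : fieldType) (tau T phi : endo k) :
    is_aut phi -> ecomp tau phi = ecomp phi T ->
  exists psi, [/\ ecomp phi psi = id_endo k, ecomp psi phi = id_endo k &
    tau = ecomp phi (ecomp T psi)].
Proof.
move=> [psi [phipsi psiphi]] comm; exists psi; split=> //.
by rewrite ecompA -comm -ecompA phipsi ecomp_id.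
Qed.

(** Applying [s] twice to [v] gives [v + p + act s p], which must be [v]. *)
Lemma involution_add_fixed (k : fieldType) (hk : 2%N \in [pchar k]) (s : endo k) (v p :
    {mpoly k[4]}) :
  involution s -> act s v = v + p -> act s p = p.
Proof.
move=> ss sv; have: act s (act s v) = v by rewrite -act_ecomp ss act_id.
rewrite sv rmorphD /= sv -addrA -[RHS]addr0 => /addrI pp.
exact: esym (addp_eq0 hk pp).
Qed.

Lemma triangular_mk4 (k : fieldType) (c : k) (p2 p3 p4 : {mpoly k[4]}) :
    in_vars 1 p2 -> in_vars 2 p3 -> in_vars 3 p4 ->
    is_aut (mk4 (vx k + c%:MP) (vy k + p2) (vz k + p3) (vw k + p4)) ->
  triangular (mk4 (vx k + c%:MP) (vy k + p2) (vz k + p3) (vw k + p4)).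
Proof.
move=> v2 v3 v4 aut; split=> //; apply: ord4_ind; exists 1; (split; first exact: oner_neq0);
  rewrite tnth_mk4 scale1r; [exists c%:MP|exists p2|exists p3|exists p4]; split=> //.
by apply/in_varsP; rewrite actC.
Qed.

(** Applying [tau] twice multiplies the coefficient of ['X_i] by [lam ^+ 2]; in characteristic two
    the only square root of 1 is 1. *)
Lemma triangular_involution_mk4 (k : fieldType) (hk : 2%N \in [pchar k]) (tau : endo k) :
    triangular tau -> involution tau ->
  exists c p2 p3 p4, [/\ in_vars 1 p2, in_vars 2 p3, in_vars 3 p4 &
    tau = mk4 (vx k + c%:MP) (vy k + p2) (vz k + p3) (vw k + p4)].
Proof.
move=> [_ tri] inv.
have step (i : 'I_4) : exists p, in_vars i p /\ tnth tau i = 'X_i + p.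
  have [lam [lam0 [p [vp Dp]]]] := tri i; exists p; split=> //.
  have coef0 (q : {mpoly k[4]}) : in_vars i q -> q@_U_(i) = 0.
    move=> vq; apply: memN_msupp_eq0; apply/negP=> /vq/(_ i (leqnn i)).
    by rewrite mnm1E eqxx.
  (* Triangularity keeps the image of [p] free of ['X_i], so it does not affect the coefficient
     compared. *)
  have vtp : in_vars i (act tau p).
    apply/in_varsP; move/in_varsP: vp => <-; rewrite -!act_ecomp; apply: act_congr.
    apply: eq_from_tnth => j; rewrite !tnth_mktuple; case: ltnP => ji; last by rewrite !raddf0.
    have [mu [_ [q [vq Dq]]]] := tri j.
    rewrite ?act_ecomp !actX Dq rmorphD /= (act_truncv_in_vars (ltnW ji) vq) actZ.
    by rewrite actX tnth_mktuple ji.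
  have: act tau (act tau 'X_i) = 'X_i by rewrite -act_ecomp inv act_id.
  rewrite actX Dp rmorphD /= actZ actX Dp.
  move/(congr1 (fun q : {mpoly k[4]} => q@_U_(i))).
  rewrite !(mcoeffD, mcoeffZ) mcoeffX eqxx (coef0 _ vtp) (coef0 _ vp) !addr0 mulr1.
  move/eqP; rewrite -expr2 sqrf_eq1 (oppr_pchar2 hk) orbb => /eqP ->.
  by rewrite scale1r.
have [p1 [v1 D1]] := step 0; have [p2 [v2 D2]] := step 1.
have [p3 [v3 D3]] := step 2; have [p4 [v4 D4]] := step 3.
(* [p1] involves no variable, hence equals its constant coefficient. *)
exists (p1@_0), p2, p3, p4; split=> //; apply: endo_eq; rewrite tnth_mk4 //.
rewrite D1; congr (_ + _); apply/mpolyP=> m; rewrite mcoeffC.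
case: eqP => [->|/eqP m0]; first by rewrite mulr1.
rewrite mulr0; apply: memN_msupp_eq0; apply: contraNN m0 => /v1 mon0.
by apply/eqP/mnmP=> j; rewrite mon0 // mnm0E.
Qed.

(** * Conjugation into the three forms *)

Lemma swap_involution (k : fieldType) : involution (mk4 (vx k) (vz k) (vy k) (vw k)).
Proof. by rewrite /involution ecomp_mk4 !act_mk4 id_endo_mk4. Qed.

(* The variables are straightened by means of [x / c], on which the involution acts
   as translation by 1. *)
Lemma conj_translation (k : fieldType) (hk : 2%N \in [pchar k]) (c : k) (p2 p3 p4 : {mpoly k[4]}) :
    c != 0 -> in_vars 1 p2 -> in_vars 2 p3 -> in_vars 3 p4 ->
  let tau := mk4 (vx k + c%:MP) (vy k + p2) (vz k + p3) (vw k + p4) in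
    involution tau ->
  exists phi, is_aut phi /\ ecomp tau phi = ecomp phi (mk4 (vx k) (vy k) (vz k) (vw k + c%:MP)).
Proof.
move=> c0 v2 v3 v4 tau inv.
pose s := c^-1%:MP * vx k; have ss : act tau s = s + 1.
  by rewrite /s rmorphM /= actC act_mk4 mulrDr -mpolyCM mulVf.
have vs m : (0 < m)%N -> in_vars m s.
  by move=> m0; apply/in_varsP; rewrite /s rmorphM /= actC actX tnth_mktuple m0.
have vsM m p : (0 < m)%N -> in_vars m p -> in_vars m (s * p).
  move=> m0 /in_varsP vp; apply/in_varsP; rewrite rmorphM /= vp.
  by rewrite ((in_varsP m s).1 (vs m m0)).
pose Ey := mk4 (vx k) (vy k + s * p2) (vz k) (vw k).
pose Ez := mk4 (vx k) (vy k) (vz k + s * p3) (vw k).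
pose Ew := mk4 (vx k) (vy k) (vz k) (vw k + s * p4).
pose sw := mk4 (vw k) (vy k) (vz k) (vx k).
have Ey_inv : involution Ey.
  rewrite /involution ecomp_mk4 !rmorphD /= !act_mk4 (act_fix1 _ _ _ (vsM _ _ _ v2)) //.
  by rewrite -addrA addpp // addr0 id_endo_mk4.
have Ez_inv : involution Ez.
  rewrite /involution ecomp_mk4 !rmorphD /= !act_mk4 (act_fix2 _ _ (vsM _ _ _ v3)) //.
  by rewrite -addrA addpp // addr0 id_endo_mk4.
have Ew_inv : involution Ew.
  rewrite /involution ecomp_mk4 !rmorphD /= !act_mk4 (act_fix3 _ (vsM _ _ _ v4)) //.
  by rewrite -addrA addpp // addr0 id_endo_mk4.
have sw_inv : involution sw by rewrite /involution ecomp_mk4 !act_mk4 id_endo_mk4.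
(* The three shears produce the invariant coordinates; [sw] then exchanges x and w, putting the
   translated variable last as in form (i). *)
exists (ecomp (ecomp Ew (ecomp Ez Ey)) sw); split.
  have [autw autz] := (involution_is_aut Ew_inv, involution_is_aut Ez_inv).
  have [auty autsw] := (involution_is_aut Ey_inv, involution_is_aut sw_inv).
  exact: is_aut_ecomp (is_aut_ecomp autw (is_aut_ecomp autz auty)) autsw.
have -> : ecomp (ecomp Ew (ecomp Ez Ey)) sw =
    mk4 (vw k + s * p4) (vy k + s * p2) (vz k + s * p3) (vx k).
  have v2' : in_vars 2 p2 := @in_vars_monotone k 1 2 p2 isT v2.
  have v2'' : in_vars 3 p2 := @in_vars_monotone k 1 3 p2 isT v2.
  have v3' : in_vars 3 p3 := @in_vars_monotone k 2 3 p3 isT v3.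
  have -> : ecomp Ez Ey = mk4 (vx k) (vy k + s * p2) (vz k + s * p3) (vw k).
    by rewrite ecomp_mk4 rmorphD /= !act_mk4 (act_fix2 _ _ (vsM _ _ _ v2')).
  rewrite !ecomp_mk4 !rmorphD /= !act_mk4.
  by rewrite (act_fix3 _ (vsM _ _ _ v2'')) // (act_fix3 _ (vsM _ _ _ v3')).
(* Since [s] moves by 1, [v + s * p] changes by [p] twice. *)
have tau_fix v p : act tau v = v + p -> act tau (v + s * p) = v + s * p.
  move=> tv; have tp := involution_add_fixed hk inv tv.
  by rewrite rmorphD rmorphM /= tv ss tp; apply: (@eq_mod2 _ hk p); ring.
rewrite !ecomp_mk4 !tau_fix ?act_mk4 // rmorphD /= act_mk4 actC //.
Qed.

Theorem mainTheorem1 (k : fieldType) (hk : 2%N \in [pchar k]) :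
  (forall T : endo k, is_aut T -> of_forms T -> involution T) /\
  (forall tau : endo k, triangular tau ->
     (involution tau <->
      exists phi psi T : endo k,
        [/\ ecomp phi psi = id_endo k, ecomp psi phi = id_endo k,
            triangular T, of_forms T &
            tau = ecomp phi (ecomp T psi)])).
Proof.
split=> [T _|tau tri]; first exact: of_forms_involution.
split=> [inv|[phi [psi [T [phipsi psiphi _ TF ->]]]]]; last first.
  exact: involution_conj psiphi phipsi (of_forms_involution hk TF).
have conj_intro phi T : is_aut phi -> ecomp tau phi = ecomp phi T -> triangular T -> of_forms T ->
    exists phi psi T : endo k,
      [/\ ecomp phi psi = id_endo k, ecomp psi phi = id_endo k,
          triangular T, of_forms T & tau = ecomp phi (ecomp T psi)].
  by move=> aut /(conj_of_intertwine aut)[psi [? ? ?]] *; exists phi, psi, T.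
have self_intro : of_forms tau -> exists phi psi T : endo k,
      [/\ ecomp phi psi = id_endo k, ecomp psi phi = id_endo k,
          triangular T, of_forms T & tau = ecomp phi (ecomp T psi)].
  by move=> ?; exists (id_endo k), (id_endo k), tau; split; rewrite ?id_ecomp ?ecomp_id.
have [c [p2 [p3 [p4 [v2 v3 v4 Dtau]]]]] := triangular_involution_mk4 hk tri inv.
have [c0|c0] := eqVneq c 0; last first.
  have [|phi [aut comm]] := @conj_translation k hk c p2 p3 p4 c0 v2 v3 v4; first by rewrite -Dtau.
  have vC m : in_vars m (c%:MP : {mpoly k[4]}) by apply/in_varsP; rewrite actC.
  have v0 m : in_vars m (0 : {mpoly k[4]}) by apply/in_varsP; rewrite raddf0.
  have TF : of_forms (mk4 (vx k) (vy k) (vz k) (vw k + c%:MP)) by left; exists c%:MP.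
  apply: (conj_intro phi _ aut _ _ TF); first by rewrite Dtau.
  have := @triangular_mk4 k 0 0 0 c%:MP (v0 _) (v0 _) (vC _); rewrite mpolyC0 !addr0; apply.
  exact/involution_is_aut/of_forms_involution.
have {c c0} Dtau : tau = mk4 (vx k) (vy k + p2) (vz k + p3) (vw k + p4).
  by rewrite Dtau c0 mpolyC0 addr0.
have tp2 : act tau p2 = p2 by apply: (involution_add_fixed hk (v := vy k) inv);
  rewrite Dtau act_mk4.
have tp3 : act tau p3 = p3 by apply: (involution_add_fixed hk (v := vz k) inv);
  rewrite Dtau act_mk4.
have tp4 : act tau p4 = p4 by apply: (involution_add_fixed hk (v := vw k) inv);
  rewrite Dtau act_mk4.
have [p20|p20] := eqVneq p2 0.
  move: Dtau; rewrite p20 addr0 => Dtau.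
  have [p30|p30] := eqVneq p3 0.
    by apply: self_intro; left; exists p4; split; rewrite // Dtau p30 addr0.
  apply: self_intro; right; left; exists p3.
  (* [p4] is free of w, so [tau] acts on it as the translation of z alone. *)
  have [|q [vq Dq]] := @shiftv_invariant k hk 2 3 2 p3 p4 isT v3 p30 v4.
    by rewrite -[RHS]tp4 Dtau shiftv2_mk4; apply: act_mk4_in_vars3.
  by exists q; split=> //; rewrite Dtau Dq ASsub2_mk4.
(* [p3] lies in [k[x,y]], where [tau] only translates y by [p2]; its invariance yields the [beta] of
   form (iii). *)
have [|beta [vbeta Dbeta]] := @shiftv_invariant k hk 1 2 1 p2 p3 isT v2 p20 v3.
  by rewrite -[RHS]tp3 Dtau shiftv1_mk4; apply: act_mk4_in_vars2.
have [p30|p30] := eqVneq p3 0.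
  (* Only y and w move here; exchanging y and z leads to form (ii) with [p2] as [xi], which lies in
     [k[x]] and is unchanged by the exchange. *)
  pose sw := mk4 (vx k) (vz k) (vy k) (vw k).
  have sw_inv : involution sw := swap_involution k.
  have swp2 : act sw p2 = p2 by apply: act_fix1.
  have vswp4 : in_vars 3 (act sw p4).
    move/in_varsP: v4 => v4; apply/in_varsP; rewrite -v4 -!act_ecomp.
    by apply: act_congr; rewrite truncv3_mk4 !ecomp_mk4 ?raddf0 !act_mk4.
  have [|q [vq Dq]] := @shiftv_invariant k hk 1 3 2 p2 (act sw p4) isT v2 p20 vswp4.
    rewrite -[in RHS]tp4 -!act_ecomp Dtau p30 addr0 shiftv2_mk4 !ecomp_mk4 !rmorphD /= !act_mk4 swp2.
    exact: act_mk4_in_vars3.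
  pose T := mk4 (vx k) (vy k) (vz k + p2) (vw k + act sw p4).
  have v22 : in_vars 2 p2 := @in_vars_monotone k 1 2 p2 isT v2.
  have TF : of_forms T.
    by right; left; exists p2, q; split=> //; rewrite /T Dq ASsub2_mk4.
  apply: (conj_intro sw T (involution_is_aut sw_inv) _ _ TF).
    rewrite Dtau p30 addr0 !ecomp_mk4 !rmorphD /= !act_mk4 swp2; congr mk4.
    by rewrite -act_ecomp sw_inv act_id.
  have v0 : in_vars 1 (0 : {mpoly k[4]}) by apply/in_varsP; rewrite raddf0.
  have := @triangular_mk4 k 0 0 p2 (act sw p4) v0 v22 vswp4; rewrite mpolyC0 !addr0; apply.
  exact/involution_is_aut/of_forms_involution.
have beta0 : beta != 0 by apply: contraNneq p30 => b0; rewrite Dbeta b0 raddf0.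
move: Dbeta; rewrite ASsub1_mk4 => Dbeta.
have [|d [a [b [gamma [gd Da Db Dp4]]]]] := gens_iii_generate hk v2 p20 vbeta beta0 v4.
  rewrite -[RHS]tp4 Dtau -Dbeta; exact: act_mk4_in_vars3.
apply: self_intro; right; right; exists p2, beta, gamma, d, a, b; split=> //; split=> //=.
by rewrite (act_fix1 _ _ _ v2) -Dbeta Dtau Dp4 -Dbeta.
Qed.
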